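(* Let $\mathcal{H}$ be a real Hilbert space, let $F_1,\dots,F_n\colon\mathcal{H}\rightrightarrows\mathcal{H}$ be maximally monotone, and let $\gamma>0$. Let $M\in\mathbb{R}^{m\times n}$, $S\in\mathbb{R}^{n\times m}$ and $N\in\mathbb{R}^{n\times n}$ be matrices, where $N$ is lower triangular with zeros on the diagonal, such that $S^*=-M$ and $M^*M+N+N^*-2\,\mathrm{Id}\preceq 0$. Let $T\colon\mathcal{H}^m\to\mathcal{H}^m$ be the operator $T(\mathbf{z})=\mathbf{z}+\gamma\mathbf{M}\mathbf{x}$, where $\mathbf{x}\in\mathcal{H}^n$ is determined by $\mathbf{x}=J_{\mathbf{F}}(\mathbf{S}\mathbf{z}+\mathbf{N}\mathbf{x})$. Then, for all $\mathbf{z},\bar{\mathbf{z}}\in\mathcal{H}^m$, we have $$\|T(\mathbf{z})-T(\bar{\mathbf{z}})\|^2+\frac{1-\gamma}{\gamma}\|(\mathrm{Id}-T)(\mathbf{z})-(\mathrm{Id}-T)(\bar{\mathbf{z}})\|^2+\gamma\langle\mathbf{x}-\bar{\mathbf{x}},[2\,\mathrm{Id}-\mathbf{M}^*\mathbf{M}-\mathbf{N}-\mathbf{N}^*](\mathbf{x}-\bar{\mathbf{x}})\rangle\leq\|\mathbf{z}-\bar{\mathbf{z}}\|^2,$$ where $\mathbf{x}=J_{\mathbf{F}}(\mathbf{S}\mathbf{z}+\mathbf{N}\mathbf{x})$ and $\bar{\mathbf{x}}=J_{\mathbf{F}}(\mathbf{S}\bar{\mathbf{z}}+\mathbf{N}\bar{\mathbf{x}})$.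 In particular, $T$ is $\gamma$-averaged nonexpansive whenever $\gamma\in(0,1)$.
   Context: For a matrix $W=(w_{ij})\in\mathbb{R}^{p\times l}$, the bold symbol $\mathbf{W}:=W\otimes\mathrm{Id}$ denotes the bounded linear operator $\mathcal{H}^l\to\mathcal{H}^p$ given by $(\mathbf{W}\mathbf{x})_i=\sum_{j=1}^l w_{ij}x_j$. The star denotes the adjoint (transpose, for real matrices), and $A\preceq 0$ means that the symmetric matrix $A$ is negative semidefinite. Powers $\mathcal{H}^m$, $\mathcal{H}^n$ carry the product Hilbert space structure. For a maximally monotone operator $F\colon\mathcal{H}\rightrightarrows\mathcal{H}$, the resolvent is $J_F:=(\mathrm{Id}+F)^{-1}$, which is single-valued with full domain. For $\mathbf{x}=(x_1,\dots,x_n)\in\mathcal{H}^n$, $\mathbf{F}(\mathbf{x}):=F_1(x_1)\times\dots\times F_n(x_n)$, and $J_{\mathbf{F}}(\mathbf{x})=(J_{F_1}(x_1),\dots,J_{F_n}(x_n))$. Since $N$ is lower triangular with zeros on the diagonal, the equation $\mathbf{x}=J_{\mathbf{F}}(\mathbf{S}\mathbf{z}+\mathbf{N}\mathbf{x})$ has exactly one solution $\mathbf{x}$ for each $\mathbf{z}$ (computed successively for $i=1,\dots,n$). An operator $R$ on a Hilbert space is $\alpha$-averaged nonexpansive if $\alpha\in(0,1)$ and, for all $x,y$, $\|R(x)-R(y)\|^2+\frac{1-\alpha}{\alpha}\|(\mathrm{Id}-R)(x)-(\mathrm{Id}-R)(y)\|^2\leq\|x-y\|^2$. *)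

(* Defs.v *)
From HB Require Import structures.
From mathcomp Require Import all_boot all_order all_algebra.
From mathcomp Require Import all_classical all_reals all_analysis.

Set Implicit Arguments.
Unset Strict Implicit.
Unset Printing Implicit Defensive.

Import Order.TTheory GRing.Theory Num.Theory.
Import numFieldNormedType.Exports.

Local Open Scope classical_set_scope.
Local Open Scope ring_scope.

Section InnerProducts.
Context (R : realType).

Definition dot_norm (V : lmodType R) (dot : {dot V for idfun}) (x : V) : R :=
  Num.sqrt (dot x x).

(* The adjoint of a bounded operator between Hilbert spaces exists and is
   unique; the default value 0 is only reached by maps without an adjoint. *)
Definition adjoint (U V : lmodType R) (dotU : {dot U for idfun})
    (dotV : {dot V for idfun}) (A : U -> V) : V -> U :=
  xget (fun=> 0) [set B | forall x y, dotV (A x) y = dotU x (B y)].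

Definition averaged_nonexpansive (V : lmodType R) (dot : {dot V for idfun})
    (alpha : R) (T : V -> V) : Prop :=
  0 < alpha < 1 /\
  forall x y : V,
    dot_norm dot (T x - T y) ^+ 2
    + (1 - alpha) / alpha * dot_norm dot ((x - T x) - (y - T y)) ^+ 2
    <= dot_norm dot (x - y) ^+ 2.

End InnerProducts.

(* The power H^n is {ffun 'I_n -> H}, with the inner product of the Hilbert
   direct sum. *)
Section PowerInnerProduct.
Context (R : realType) (H : lmodType R) (dot : {dot H for idfun}) (n : nat).

Definition pdot (x y : {ffun 'I_n -> H}) : R := \sum_i dot (x i) (y i).

Let pdot_linearl y : linear_for *%R (pdot^~ y).
Proof.
move=> a u v; rewrite /pdot mulr_sumr -big_split /=.
by apply: eq_bigr => i _; rewrite !ffunE linearPl.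
Qed.

Let pdot_linearr x : linear_for *%R (pdot x).
Proof.
move=> a u v; rewrite /pdot mulr_sumr -big_split /=.
by apply: eq_bigr => i _; rewrite !ffunE linearPr.
Qed.

HB.instance Definition _ := bilinear_isBilinear.Build R
  {ffun 'I_n -> H} {ffun 'I_n -> H} R *%R (idfun \; *%R) pdot
  (pdot_linearl, pdot_linearr).

Let pdot_sym x y : pdot x y = (-1) ^+ false * idfun (pdot y x).
Proof.
by rewrite expr0 mul1r; apply: eq_bigr => i _; rewrite hermC expr0 mul1r.
Qed.

HB.instance Definition _ := isHermitianSesquilinear.Build R
  {ffun 'I_n -> H} false idfun pdot pdot_sym.

Let pdot_gt0 x : x != 0 -> 0 < pdot x x.
Proof.
have ge0 (u : H) : 0 <= dot u u.
  have [->|u0] := eqVneq u 0; first by rewrite linear0r.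
  exact/ltW/neq0_dnorm_gt0.
move=> x0; rewrite lt_neqAle sumr_ge0 1?eq_sym ?andbT //.
apply: contra x0; rewrite psumr_eq0// => /allP xi0.
apply/eqP/ffunP => i; rewrite ffunE; apply: contraTeq isT => xi.
by have := xi0 i (mem_index_enum _); rewrite gt_eqF// neq0_dnorm_gt0.
Qed.

HB.instance Definition _ := isDotProduct.Build R
  {ffun 'I_n -> H} pdot pdot_gt0.

End PowerInnerProduct.

Arguments pdot {R H} dot n x y.

Definition neg_semidefinite (R : realType) (n : nat) (A : 'M[R]_n) : Prop :=
  A^T = A /\ forall v : 'cV[R]_n, (v^T *m A *m v) 0 0 <= 0.

(* W (x) Id *)
Definition kron_id (R : realType) (H : lmodType R) (p l : nat)
    (W : 'M[R]_(p, l)) (x : {ffun 'I_l -> H}) : {ffun 'I_p -> H} :=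
  [ffun i => \sum_j W i j *: x j].

(* A set-valued operator on H is a map H -> set H. *)
Section MonotoneOperators.
Context (R : realType) (H : lmodType R).
Implicit Types F G : H -> set H.

Definition monotone_op (dot : {dot H for idfun}) F : Prop :=
  forall x y u v, F x u -> F y v -> 0 <= dot (x - y) (u - v).

Definition maximally_monotone (dot : {dot H for idfun}) F : Prop :=
  monotone_op dot F /\
  forall G, monotone_op dot G -> (forall x, F x `<=` G x) ->
    forall x, G x = F x.

Definition id_plus F : H -> set H := fun x => [set x + u | u in F x].

Definition inv_op G : H -> set H := fun y => [set x | G x y].

(* The point of the set-valued inverse (Id + F)^-1 at y; for F maximally
   monotone on a Hilbert space this set is a singleton (Minty), so the default
   value 0 is not reached. *)
Definition resolvent F (y : H) : H := xget 0 (inv_op (id_plus F) y).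

Definition resolvents (n : nat) (F : 'I_n -> H -> set H)
    (x : {ffun 'I_n -> H}) : {ffun 'I_n -> H} :=
  [ffun i => resolvent (F i) (x i)].

Definition is_resolvent_point (m n : nat) (F : 'I_n -> H -> set H)
    (S : 'M[R]_(n, m)) (N : 'M[R]_n)
    (z : {ffun 'I_m -> H}) (x : {ffun 'I_n -> H}) : Prop :=
  x = resolvents F (kron_id S z + kron_id N x).

(* When N is strictly lower triangular, the equation on x has exactly one
   solution, computed coordinate by coordinate. *)
Definition resolvent_point (m n : nat) (F : 'I_n -> H -> set H)
    (S : 'M[R]_(n, m)) (N : 'M[R]_n) (z : {ffun 'I_m -> H}) :
    {ffun 'I_n -> H} :=
  xget 0 [set x | is_resolvent_point F S N z x].

Definition splitting_op (m n : nat) (gamma : R) (F : 'I_n -> H -> set H)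
    (M : 'M[R]_(m, n)) (S : 'M[R]_(n, m)) (N : 'M[R]_n)
    (z : {ffun 'I_m -> H}) : {ffun 'I_m -> H} :=
  z + gamma *: kron_id M (resolvent_point F S N z).

End MonotoneOperators.

(* Main.v *)
Require Import Defs.
From mathcomp Require Import all_boot all_order all_algebra.
From mathcomp Require Import all_classical all_reals all_analysis.
From mathcomp Require Import ring lra.

Set Implicit Arguments.
Unset Strict Implicit.
Unset Printing Implicit Defensive.

Import Order.TTheory GRing.Theory Num.Theory.
Import numFieldNormedType.Exports.

Local Open Scope classical_set_scope.
Local Open Scope ring_scope.

(** Write [d := x - x'], [e := z - z'], [w := M d]. Each [x i] is a resolvent
    value, so the increments of [S z + N x - x] are increments of values of the
    monotone operators [F i] between the points [x i] and [x' i], and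
    monotonicity gives [0 <= <d, S e + N d - d>]
    ([resolvents_monotone]). As [S^T = - M], this reads
    [<w, e> + |d|^2 - <d, N d> <= 0]. On the other hand
    [T z - T z' = e + gamma w] and the increment of [Id - T] is [- gamma w],
    so after expanding the squares the left-hand side exceeds [|e|^2] by [2 gamma] times that nonpositive
    quantity ([km_inequality]): the terms in [|w|^2] cancel. Averagedness
    follows because the third term is nonnegative: a matrix that is positive
    semidefinite on real vectors stays so when it acts on tuples of vectors
    of an inner product space ([pdot_kron_ge0]).

    Two existence results make the objects in this argument meaningful. The
    equation for [x] has exactly one solution since its [i]-th line only
    involves the previous coordinates ([resolvent_pointP],
    [resolvent_point_unique]). More substantially, the resolvent of a maximally
    monotone operator must be defined everywhere: this is Minty's theorem
    ([minty]), proved here from the Fitzpatrick function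
    [phi (x, u) = sup (<x, v> + <a, u> - <a, v>)], the supremum being over the
    graph of [F]. It is a convex lower semicontinuous function, equal to
    [<x, u>] on the graph and at least [<x, u>] everywhere, so
    [phi + |.|^2 / 2] is nonnegative and strongly convex and has a minimizer
    [(x, u)] in [H * H]. The optimality condition there says that
    [(- u, - x)] is monotonically related to the whole graph, hence belongs to
    it, and then that [x = - u]; thus [- x] belongs to [F x]. Applying this to a
    translate of [F] gives surjectivity of [Id + F]. *)

(** * Real inner products *)

Section DotAlgebra.
Context (R : realType) (V : lmodType R) (dot : {dot V for idfun}).
Implicit Types (x y z : V) (a : R).

Lemma dotC x y : dot x y = dot y x.
Proof. by rewrite hermC expr0 mul1r. Qed.

Lemma dotDr x y z : dot x (y + z) = dot x y + dot x z.
Proof. exact: linearDr. Qed.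

Lemma dotNr x y : dot x (- y) = - dot x y.
Proof. exact: linearNr. Qed.

Lemma dotZr a x y : dot x (a *: y) = a * dot x y.
Proof. exact: linearZr. Qed.

Lemma dotDl x y z : dot (x + y) z = dot x z + dot y z.
Proof. by rewrite dotC dotDr !(dotC z). Qed.

Lemma dotNl x y : dot (- x) y = - dot x y.
Proof. by rewrite dotC dotNr dotC. Qed.

Lemma dotZl a x y : dot (a *: x) y = a * dot x y.
Proof. by rewrite dotC dotZr dotC. Qed.

Definition dotE := (dotDl, dotDr, dotNl, dotNr, dotZl, dotZr).

Lemma dot0l x : dot 0 x = 0.
Proof. exact: linear0l. Qed.

Lemma dot_sumr I (r : seq I) x (f : I -> V) :
  dot x (\sum_(i <- r) f i) = \sum_(i <- r) dot x (f i).
Proof.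
by elim/big_ind2: _ => [|? ? ? ? <- <-|//]; rewrite ?dotDr// dotC dot0l.
Qed.

Lemma dot_gt0 x : x != 0 -> 0 < dot x x.
Proof. exact: neq0_dnorm_gt0. Qed.

Lemma dot_ge0 x : 0 <= dot x x.
Proof. by have [->|/dot_gt0/ltW//] := eqVneq x 0; rewrite dot0l. Qed.

Lemma dot_eq0 x : dot x x <= 0 -> x = 0.
Proof. by apply: contraTeq => /dot_gt0; rewrite -ltNge. Qed.

Lemma dot_normK x : dot_norm dot x ^+ 2 = dot x x.
Proof. by rewrite sqr_sqrtr// dot_ge0. Qed.

End DotAlgebra.

Arguments dotC {R V} dot x y.

(** * Minty's theorem *)

Section Minty.
Context (R : realType) (H : completeNormedModType R) (dot : {dot H for idfun}).
Hypothesis dot_normE : forall x : H, `|x| = dot_norm dot x.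

Lemma sqr_normE (x : H) : `|x| ^+ 2 = dot x x.
Proof. by rewrite dot_normE dot_normK. Qed.

(** Polarization reduces the continuity of the inner product to that of the
    norm. *)
Lemma dot_polar (x y : H) :
  dot x y = 2^-1 * (`|x + y| ^+ 2 - `|x| ^+ 2 - `|y| ^+ 2).
Proof. by rewrite !sqr_normE !dotE (dotC _ y x); field. Qed.

Lemma cvg_dot (x y : nat -> H) (a b : H) :
  x @ \oo --> a -> y @ \oo --> b -> dot (x k) (y k) @[k --> \oo] --> dot a b.
Proof.
move=> xa yb.
have sq (z : nat -> H) c :
    z @ \oo --> c -> `|z k| ^+ 2 @[k --> \oo] --> `|c| ^+ 2.
  move=> zc; rewrite expr2; under eq_fun do rewrite expr2.
  by apply: cvgM; exact: cvg_norm.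
under eq_fun do rewrite dot_polar.
rewrite dot_polar; apply: cvgM; first exact: cvg_cst.
apply: cvgB (sq _ _ yb); apply: cvgB (sq _ _ xa); apply: sq.
exact: cvgD.
Qed.

Lemma dot_cauchy_cvg (x : nat -> H) (c : R) :
  (forall k l, (k <= l)%N -> dot (x k - x l) (x k - x l) <= c * k.+1%:R^-1) ->
  cvg (x @ \oo).
Proof.
move=> xP; apply/cauchy_cvgP/cauchy_exP => e e0.
have c0 : 0 < `|c| + 1 by rewrite ltr_wpDl.
have d0 : 0 < e ^+ 2 / (`|c| + 1) by rewrite divr_gt0// exprn_gt0.
have [k _ kP] := near_infty_natSinv_lt (PosNum d0).
exists (x k); exists k => // l /= kl.
rewrite -ball_normE /ball_ /=.
rewrite -(ltr_pXn2r (_ : 0 < 2)%N) ?nnegrE ?(ltW e0)// sqr_normE.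
apply: le_lt_trans (xP _ _ kl) _.
have := kP k (leqnn k); rewrite /= ltr_pdivlMr// mulrC; apply: le_lt_trans.
by rewrite ler_wpM2r// (le_trans (ler_norm c))// lerDl.
Qed.

Variable F : H -> set H.
Hypothesis F_max : maximally_monotone dot F.

(** Adding a point that is monotonically related to the graph keeps the graph
    monotone, so maximality says that the point was already there. *)
Lemma maximally_monotone_mem x u :
  (forall a v, F a v -> 0 <= dot (x - a) (u - v)) -> F x u.
Proof.
case: F_max => Fmon Fmax xuF.
pose G y w := F y w \/ (y = x /\ w = u).
have -> : F x = G x.
  apply/esym/(Fmax G) => [y y' w w'|y w Fyw]; last by left.
  case=> [Fyw|[-> ->]] [Fyw'|[-> ->]].
  - exact: Fmon.
  - by rewrite -(opprB x) -(opprB u) dotNl dotNr opprK; exact: xuF.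
  - exact: xuF.
  - by rewrite !subrr dot0l.
by right.
Qed.

(** The epigraph of the Fitzpatrick function of [F]. Working with it instead of
    the function avoids the value [+oo], which the supremum can take. *)
Definition fitzpatrick_epi (x u : H) (t : R) :=
  forall a v, F a v -> dot x v + dot a u - dot a v <= t.

Lemma fitzpatrick_graph a v : F a v -> fitzpatrick_epi a v (dot a v).
Proof.
move=> Fav b w Fbw; have := F_max.1 _ _ _ _ Fav Fbw; rewrite !dotE; lra.
Qed.

(** If [t < <x, u>], the pair [(x, u)] is monotonically related to the graph,
    hence in it; but there the Fitzpatrick function is at least [<x, u>]. *)
Lemma fitzpatrick_ge_dot x u t : fitzpatrick_epi x u t -> dot x u <= t.
Proof.
move=> xut; rewrite leNgt; apply/negP => tlt.
suff /xut : F x u by rewrite leNgt; apply/negP; lra.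
apply: maximally_monotone_mem => a v /xut; rewrite !dotE; lra.
Qed.

Lemma fitzpatrick_convex (s : R) x u t x' u' t' : 0 <= s <= 1 ->
  fitzpatrick_epi x u t -> fitzpatrick_epi x' u' t' ->
  fitzpatrick_epi (x + s *: (x' - x)) (u + s *: (u' - u)) (t + s * (t' - t)).
Proof.
move=> /andP[s0 s1] xut xut' a v Fav.
have := xut _ _ Fav; have := xut' _ _ Fav; rewrite !dotE; nra.
Qed.

(* The strongly convex function whose minimization yields a zero of Id + F. *)
Let energy x u t : R := 2^-1 * (dot x x + dot u u) + t.

Lemma energy_ge0 x u t : fitzpatrick_epi x u t -> 0 <= energy x u t.
Proof.
move=> /fitzpatrick_ge_dot; have := dot_ge0 dot (x + u).
by rewrite /energy !dotE (dotC _ u x); lra.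
Qed.

Lemma maximally_monotone_nonempty : exists a v, F a v.
Proof.
have [//|F0] := pselect (exists a v, F a v).
exists 0, 0; apply: maximally_monotone_mem => a v Fav.
by case: F0; exists a, v.
Qed.

(** A minimizing sequence is Cauchy by the parallelogram identity applied to
    midpoints, and the constraints of the epigraph pass to the limit since the
    inner product is continuous. *)
Lemma energy_minimizer : exists x u t, fitzpatrick_epi x u t /\
  forall x' u' t', fitzpatrick_epi x' u' t' -> energy x u t <= energy x' u' t'.
Proof.
pose E := [set h | exists x u t, fitzpatrick_epi x u t /\ h = energy x u t].
have Einf : has_inf E.
  split; last by exists 0 => _ [x [u [t [xut ->]]]]; exact: energy_ge0.
  have [a [v Fav]] := maximally_monotone_nonempty.
  exists (energy a v (dot a v)), a, v, (dot a v); split=> //.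
  exact: fitzpatrick_graph.
pose d := inf E.
have dle x u t : fitzpatrick_epi x u t -> d <= energy x u t.
  by move=> xut; apply: ge_inf; [exact: Einf.2|exists x, u, t].
have : forall k, exists w : H * H * R,
    fitzpatrick_epi w.1.1 w.1.2 w.2 /\
    energy w.1.1 w.1.2 w.2 <= d + k.+1%:R^-1.
  move=> k.
  have [|_ [x [u [t [xut ->]]]] hlt] := @inf_adherent _ E k.+1%:R^-1 _ Einf.
    by rewrite invr_gt0.
  by exists (x, u, t); split=> //; exact: ltW.
move=> /choice[w wP].
pose x k := (w k).1.1; pose u k := (w k).1.2; pose t k := (w k).2.
have gap k l : (k <= l)%N ->
    dot (x k - x l) (x k - x l) + dot (u k - u l) (u k - u l)
    <= 8 * k.+1%:R^-1.
  move=> kl; have [wk hk] := wP k; have [wl hl] := wP l.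
  have lk : l.+1%:R^-1 <= k.+1%:R^-1 :> R by rewrite lef_pV2 ?posrE// ler_nat.
  have half : 0 <= (2^-1 : R) <= 1 by lra.
  have := dle _ _ _ (fitzpatrick_convex half wk wl).
  move: hk hl lk; rewrite /energy -/(x k) -/(u k) -/(t k)
    -/(x l) -/(u l) -/(t l).
  rewrite !dotE (dotC _ (x l) (x k)) (dotC _ (u l) (u k)).
  by move: k.+1%:R^-1 l.+1%:R^-1 => ek el; lra.
have /cvg_ex[x0 xx0] : cvg (x @ \oo).
  apply: (@dot_cauchy_cvg x 8) => k l /gap.
  by apply: le_trans; rewrite lerDl dot_ge0.
have /cvg_ex[u0 uu0] : cvg (u @ \oo).
  apply: (@dot_cauchy_cvg u 8) => k l /gap.
  by apply: le_trans; rewrite lerDr dot_ge0.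
(* The heights need not be shown to converge: the value of the infimum
   dictates the height of the minimizer. *)
exists x0, u0, (d - 2^-1 * (dot x0 x0 + dot u0 u0)); split; last first.
  by move=> x' u' t' /dle; rewrite /energy subrKC.
move=> a v Fav.
have cst (c : H) : (fun=> c) @ \oo --> c by exact: cvg_cst.
have lhs : (dot (x k) v + dot a (u k) - dot a v
    + 2^-1 * (dot (x k) (x k) + dot (u k) (u k))) @[k --> \oo]
    --> dot x0 v + dot a u0 - dot a v + 2^-1 * (dot x0 x0 + dot u0 u0).
  apply: cvgD; last by apply: cvgM;
    [exact: cvg_cst|apply: cvgD; exact: cvg_dot].
  apply: cvgB; last exact: cvg_cst.
  by apply: cvgD; exact: cvg_dot.
have rhs : (d + k.+1%:R^-1) @[k --> \oo] --> d + 0.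
  by apply: cvgD; [exact: cvg_cst|exact: cvg_harmonic].
have := ler_cvg_to lhs rhs; rewrite addr0 lerBrDr; apply.
apply: nearW => k; have [/(_ _ _ Fav) wk hk] := wP k.
by apply: le_trans hk; rewrite /energy -/(x k) -/(u k) -/(t k) addrC lerD2l.
Qed.

Lemma first_order_ge0 (A B : R) :
  (forall s, 0 < s <= 1 -> 0 <= s * A + s ^+ 2 * B) -> 0 <= A.
Proof.
move=> AB; rewrite leNgt; apply/negP => A0.
have B0 : 0 <= B by have := AB 1; rewrite ltr01 lexx => /(_ isT); lra.
have den : 0 < B - A by lra.
(* The parabola is negative on ]0, - A / B[; this s lies there and below 1,
   and makes sense when B = 0. *)
pose s := - A / 2 / (B - A).
have s0 : 0 < s by rewrite !divr_gt0//; lra.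
have sE : s * (B - A) = - A / 2 by rewrite mulfVK// gt_eqF.
have s1 : s <= 1 by nra.
have := AB s; rewrite s0 s1 => /(_ isT); nra.
Qed.

(** First-order optimality: moving from the minimizer towards another point of
    the epigraph by a fraction [s] changes the energy by a nonnegative amount,
    whose part linear in [s] must then be nonnegative. *)
Lemma energy_minimizer_subgradient x u t : fitzpatrick_epi x u t ->
  (forall x' u' t', fitzpatrick_epi x' u' t' ->
    energy x u t <= energy x' u' t') ->
  forall x' u' t', fitzpatrick_epi x' u' t' ->
    t <= t' + dot x (x' - x) + dot u (u' - u).
Proof.
move=> xut xumin x' u' t' xut'.
rewrite -subr_ge0.
apply: (@first_order_ge0 _
  (2^-1 * (dot (x' - x) (x' - x) + dot (u' - u) (u' - u)))) => s /andP[s0 s1].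
have s01 : 0 <= s <= 1 by rewrite s1 ltW.
have := xumin _ _ _ (fitzpatrick_convex s01 xut xut').
rewrite /energy !dotE (dotC _ x' x) (dotC _ u' u); lra.
Qed.

(** Optimality tested at graph points bounds [|x + u|^2] by
    [<- u - a, - x - v>]. This puts [(- u, - x)] in the graph, and testing at
    that very point gives [x + u = 0]. *)
Theorem maximally_monotone_zero : exists p, F p (- p).
Proof.
have [x [u [t [xut xumin]]]] := energy_minimizer.
have sub := energy_minimizer_subgradient xut xumin.
have xu_t := fitzpatrick_ge_dot xut.
have key a v : F a v -> dot (x + u) (x + u) <= dot (- u - a) (- x - v).
  move=> /fitzpatrick_graph/sub; rewrite !dotE (dotC _ u x) (dotC _ a x); lra.
have Fux : F (- u) (- x).
  apply: maximally_monotone_mem => a v /key; apply: le_trans; exact: dot_ge0.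
have /eqP : x + u = 0.
  by apply: (@dot_eq0 _ _ dot); have := key _ _ Fux; rewrite subrr dot0l.
by rewrite addr_eq0 => /eqP xu; exists x; rewrite {1}xu.
Qed.

End Minty.

Lemma maximally_monotone_shift (R : realType) (H : lmodType R)
    (dot : {dot H for idfun}) (F : H -> set H) (y : H) :
  maximally_monotone dot F ->
  maximally_monotone dot (fun x => [set u | F x (u + y)]).
Proof.
move=> [Fmon Fmax]; split=> [x x' u u' /Fmon /[apply]|G Gmon FG x].
  by rewrite opprD addrACA subrr addr0.
have GF : forall x, [set u | G x (u - y)] = F x.
  apply: Fmax => [x1 x2 u u' /Gmon /[apply]|x1 u /= Fu].
    by rewrite opprB addrA subrK.
  by apply: FG => /=; rewrite subrK.
by rewrite -GF; apply/seteqP; split=> u /=; rewrite addrK.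
Qed.

Theorem minty (R : realType) (H : completeNormedModType R)
    (dot : {dot H for idfun}) (dot_normE : forall x : H, `|x| = dot_norm dot x)
    (F : H -> set H) (y : H) :
  maximally_monotone dot F -> exists x, F x (y - x).
Proof.
move=> /(maximally_monotone_shift y) /(maximally_monotone_zero dot_normE)[x Fx].
by exists x; rewrite addrC.
Qed.

(** * Fixed points of triangular systems *)

Section Causal.
Context (T : Type) (n : nat) (G : {ffun 'I_n -> T} -> {ffun 'I_n -> T}).
Hypothesis G_causal : forall (x y : {ffun 'I_n -> T}) (i : 'I_n),
  (forall j : 'I_n, (j < i)%N -> x j = y j) -> G x i = G y i.

(** The first [k] coordinates of the iterates are constant from step [k] on. *)
Lemma causal_fixpoint_exists (x0 : {ffun 'I_n -> T}) : exists x, x = G x.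
Proof.
have stab k : forall i : 'I_n, (i < k)%N -> iter k G x0 i = iter k.+1 G x0 i.
  elim: k => // k IHk i; rewrite ltnS => ik; rewrite !iterS.
  by apply: G_causal => j ji; apply: IHk; exact: leq_trans ik.
by exists (iter n G x0); apply/ffunP => i; rewrite stab.
Qed.

Lemma causal_fixpoint_unique x y : x = G x -> y = G y -> x = y.
Proof.
move=> xG yG; apply/ffunP => i.
have [k] := ubnP i; elim: k i => // k IHk i; rewrite ltnS => ik.
rewrite xG yG; apply: G_causal => j ji; apply: IHk; exact: leq_trans ik.
Qed.

End Causal.

(** * Real matrices acting on powers of an inner product space *)

Section Kron.
Context (R : realType) (H : lmodType R) (dot : {dot H for idfun}).

Lemma kron_idB p l (A : 'M[R]_(p, l)) (x y : {ffun 'I_l -> H}) :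
  kron_id A (x - y) = kron_id A x - kron_id A y.
Proof.
apply/ffunP => i; rewrite !ffunE -sumrB; apply: eq_bigr => j _.
by rewrite !ffunE scalerBr.
Qed.

Lemma kron_idD_mx p l (A B : 'M[R]_(p, l)) (x : {ffun 'I_l -> H}) :
  kron_id (A + B) x = kron_id A x + kron_id B x.
Proof.
apply/ffunP => i; rewrite !ffunE -big_split; apply: eq_bigr => j _.
by rewrite mxE scalerDl.
Qed.

Lemma kron_idN_mx p l (A : 'M[R]_(p, l)) (x : {ffun 'I_l -> H}) :
  kron_id (- A) x = - kron_id A x.
Proof.
apply/ffunP => i; rewrite !ffunE -sumrN; apply: eq_bigr => j _.
by rewrite mxE scaleNr.
Qed.

Lemma kron_idM p q l (A : 'M[R]_(p, q)) (B : 'M[R]_(q, l))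
    (x : {ffun 'I_l -> H}) :
  kron_id (A *m B) x = kron_id A (kron_id B x).
Proof.
apply/ffunP => i; rewrite !ffunE.
under eq_bigr do rewrite mxE scaler_suml.
rewrite exchange_big; apply: eq_bigr => k _; rewrite ffunE scaler_sumr.
by apply: eq_bigr => j _; rewrite scalerA.
Qed.

Lemma kron_id_scalar p (a : R) (x : {ffun 'I_p -> H}) : kron_id a%:M x = a *: x.
Proof.
apply/ffunP => i; rewrite !ffunE (bigD1 i)//= mxE eqxx mulr1n.
rewrite big1 ?addr0// => j ji.
by rewrite mxE eq_sym (negPf ji) mulr0n scale0r.
Qed.

Lemma pdot_kron_tr p l (A : 'M[R]_(p, l))
    (x : {ffun 'I_l -> H}) (y : {ffun 'I_p -> H}) :
  pdot dot p (kron_id A x) y = pdot dot l x (kron_id A^T y).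
Proof.
rewrite /pdot.
under eq_bigr do rewrite ffunE dotC dot_sumr.
rewrite exchange_big; apply: eq_bigr => j _; rewrite ffunE dot_sumr.
by apply: eq_bigr => i _; rewrite !dotZr mxE dotC.
Qed.

(** The transpose acts as an adjoint, so the chosen adjoint satisfies the
    defining identity. *)
Lemma adjoint_kronP p l (A : 'M[R]_(p, l))
    (x : {ffun 'I_l -> H}) (y : {ffun 'I_p -> H}) :
  pdot dot l x (adjoint (pdot dot l) (pdot dot p) (kron_id A) y)
  = pdot dot p (kron_id A x) y.
Proof.
have := @xgetPex _ (fun=> 0) [set B | forall x y,
  pdot dot p (kron_id A x) y = pdot dot l x (B y)].
rewrite -/(adjoint _ _ _) => -> //.
by exists (kron_id A^T) => x' y'; exact: pdot_kron_tr.
Qed.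

(** One Gram-Schmidt step on the vectors: projecting them on the line of a
    nonzero [d i0] and on its orthogonal splits the form into a value of the
    real quadratic form and the same form on the orthogonal parts, of
    which fewer are nonzero. *)
Lemma pdot_kron_ge0 n (A : 'M[R]_n) (d : {ffun 'I_n -> H}) :
  (forall v : 'cV[R]_n, 0 <= (v^T *m A *m v) 0 0) ->
  0 <= pdot dot n d (kron_id A d).
Proof.
move=> A_psd.
have pdotE (e : {ffun 'I_n -> H}) :
    pdot dot n e (kron_id A e) = \sum_i \sum_j A i j * dot (e i) (e j).
  apply: eq_bigr => i _; rewrite ffunE dot_sumr.
  by apply: eq_bigr => j _; rewrite dotZr.
have [k] := ubnP #|[pred i | d i != 0]|; elim: k d => // k IHk d.
rewrite ltnS => card_d.
have [d0|/existsP[i0 di0]] := boolP [forall i, d i == 0].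
  rewrite pdotE big1 // => i _; rewrite big1 // => j _.
  by rewrite (eqP (forallP d0 i)) dot0l mulr0.
pose f := d i0.
have f0 : 0 < dot f f by exact: dot_gt0.
pose c i := dot (d i) f / dot f f.
pose d' := [ffun i => d i - c i *: f].
have fd' i : dot f (d' i) = 0.
  by rewrite ffunE dotDr dotNr dotZr /c mulfVK ?gt_eqF// dotC subrr.
have dE i : d i = d' i + c i *: f by rewrite ffunE subrK.
have -> : pdot dot n d (kron_id A d) = pdot dot n d' (kron_id A d')
    + dot f f * ((\col_i c i)^T *m A *m \col_i c i) 0 0.
  rewrite !pdotE !mxE mulr_sumr.
  under [X in _ = _ + X]eq_bigr => j _.
    rewrite !mxE mulr_suml mulr_sumr; under eq_bigr do rewrite !mxE.
    over.
  rewrite [X in _ = _ + X]exchange_big -big_split; apply: eq_bigr => i _.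
  rewrite -big_split; apply: eq_bigr => j _ /=.
  rewrite [in LHS](dE i) [in LHS](dE j) !dotE !fd' (dotC _ (d' i) f) fd'; ring.
apply: addr_ge0; last by rewrite mulr_ge0// ltW.
apply: IHk; apply: leq_trans card_d; apply: proper_card.
apply/properP; split.
  apply/fintype.subsetP => i; rewrite !inE ffunE; apply: contraNneq => di.
  by rewrite /c di dot0l mul0r scale0r subrr.
exists i0; rewrite !inE ?di0// ffunE negbK /c mulfV ?gt_eqF//.
by rewrite scale1r subrr.
Qed.

End Kron.

(** * The averagedness estimate *)

(** With [s] and [t] standing for [S e] and [N d], the two sides differ by
    [2 gamma] times the inner product assumed nonnegative. *)
Lemma km_inequality (R : realType) (U V : lmodType R)
    (dotU : {dot U for idfun}) (dotV : {dot V for idfun})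
    (gamma : R) (e w : U) (d s t : V) : 0 < gamma ->
  dotV d s = - dotU w e -> 0 <= dotV d (s + t - d) ->
  dotU (e + gamma *: w) (e + gamma *: w)
  + (1 - gamma) / gamma * dotU (gamma *: w) (gamma *: w)
  + gamma * (2 * dotV d d - dotU w w - 2 * dotV d t) <= dotU e e.
Proof.
move=> g0 ds; rewrite !dotE ds (dotC _ e w) => mono.
have -> : (1 - gamma) / gamma * (gamma * (gamma * dotU w w))
    = (1 - gamma) * gamma * dotU w w by field; rewrite gt_eqF.
nra.
Qed.

(** * Resolvents *)

Section Resolvent.
Context (R : realType) (H : completeNormedModType R) (dot : {dot H for idfun}).
Hypothesis dot_normE : forall x : H, `|x| = dot_norm dot x.

Lemma resolvent_mem (F : H -> set H) (y : H) : maximally_monotone dot F ->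
  F (resolvent F y) (y - resolvent F y).
Proof.
move=> /(minty dot_normE y)[x Fx].
have [u Fu yE] : inv_op (id_plus F) y (resolvent F y).
  by apply: xgetPex; exists x; exists (y - x) => //; rewrite subrKC.
suff -> : y - resolvent F y = u by [].
by rewrite -[X in X - _]yE addrC addKr.
Qed.

Lemma resolvents_monotone n (F : 'I_n -> H -> set H) (y y' : {ffun 'I_n -> H}) :
  (forall i, maximally_monotone dot (F i)) ->
  0 <= pdot dot n (resolvents F y - resolvents F y')
    (y - y' - (resolvents F y - resolvents F y')).
Proof.
move=> Fmax; apply: sumr_ge0 => i _.
have := (Fmax i).1 _ _ _ _ (resolvent_mem (y i) (Fmax i))
  (resolvent_mem (y' i) (Fmax i)).
by rewrite !ffunE opprD addrACA -opprD.
Qed.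

End Resolvent.

Section Points.
Context (R : realType) (H : lmodType R) (m n : nat) (F : 'I_n -> H -> set H).
Context (S : 'M[R]_(n, m)) (N : 'M[R]_n).
Hypotheses (N_trig : is_trig_mx N) (N_diag : forall i, N i i = 0).

Let step z (x : {ffun 'I_n -> H}) := resolvents F (kron_id S z + kron_id N x).

Lemma step_causal z (x y : {ffun 'I_n -> H}) (i : 'I_n) :
  (forall j : 'I_n, (j < i)%N -> x j = y j) -> step z x i = step z y i.
Proof.
move=> xy; rewrite !ffunE; do 2 congr (_ _ _); apply: eq_bigr => j _.
have [/xy -> //|ij|/val_inj->] := ltngtP j i.
  by rewrite (is_trig_mxP N_trig)// !scale0r.
by rewrite N_diag !scale0r.
Qed.

Lemma resolvent_pointP z : is_resolvent_point F S N z (resolvent_point F S N z).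
Proof.
apply: (@xgetPex _ 0 [set x | is_resolvent_point F S N z x]).
exact: (causal_fixpoint_exists (@step_causal z) 0).
Qed.

Lemma resolvent_point_unique z x :
  is_resolvent_point F S N z x -> resolvent_point F S N z = x.
Proof.
exact: (causal_fixpoint_unique (@step_causal z) (resolvent_pointP z)).
Qed.

End Points.

Theorem lemma2p4 (R : realType) (H : completeNormedModType R)
  (dot : {dot H for idfun}) (dot_normE : forall x : H, `|x| = dot_norm dot x)
  (m n : nat) (F : 'I_n -> H -> set H)
  (F_maxmon : forall i, maximally_monotone dot (F i))
  (gamma : R) (gamma_gt0 : 0 < gamma)
  (M : 'M[R]_(m, n)) (S : 'M[R]_(n, m)) (N : 'M[R]_n)
  (N_trig : is_trig_mx N) (N_diag : forall i, N i i = 0)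
  (S_M : S^T = - M)
  (MN_nsd : neg_semidefinite (M^T *m M + N + N^T - 2%:M)) :
  let T := splitting_op gamma F M S N in
  let dotm : {dot {ffun 'I_m -> H} for idfun} := pdot dot m in
  let dotn : {dot {ffun 'I_n -> H} for idfun} := pdot dot n in
  (forall (z z' : {ffun 'I_m -> H}) (x x' : {ffun 'I_n -> H}),
    is_resolvent_point F S N z x ->
    is_resolvent_point F S N z' x' ->
    dot_norm dotm (T z - T z') ^+ 2
    + (1 - gamma) / gamma
      * dot_norm dotm ((z - T z) - (z' - T z')) ^+ 2
    + gamma * dotn (x - x')
        (2 *: (x - x')
         - adjoint dotn dotm (kron_id M) (kron_id M (x - x'))
         - kron_id N (x - x')
         - adjoint dotn dotn (kron_id N) (x - x'))
    <= dot_norm dotm (z - z') ^+ 2)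
  /\ (gamma < 1 -> averaged_nonexpansive dotm gamma T).
Proof.
move=> T dotm dotn.
have defectE (d : {ffun 'I_n -> H}) :
    dotn d (2 *: d - adjoint dotn dotm (kron_id M) (kron_id M d)
      - kron_id N d - adjoint dotn dotn (kron_id N) d)
    = 2 * dotn d d - dotm (kron_id M d) (kron_id M d)
      - 2 * dotn d (kron_id N d).
  have adjM : dotn d (adjoint dotn dotm (kron_id M) (kron_id M d))
    = dotm (kron_id M d) (kron_id M d) by exact: adjoint_kronP.
  have adjN : dotn d (adjoint dotn dotn (kron_id N) d) = dotn (kron_id N d) d.
    exact: adjoint_kronP.
  by rewrite !dotE adjM adjN (dotC dotn (kron_id N d)); lra.
have defect_ge0 (d : {ffun 'I_n -> H}) : 0 <= 2 * dotn d d
    - dotm (kron_id M d) (kron_id M d) - 2 * dotn d (kron_id N d).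
  have trM : dotn d (kron_id M^T (kron_id M d))
    = dotm (kron_id M d) (kron_id M d) by exact/esym/pdot_kron_tr.
  have trN : dotn d (kron_id N^T d) = dotn d (kron_id N d).
    by rewrite (dotC dotn d (kron_id N d)); exact/esym/pdot_kron_tr.
  have /(pdot_kron_ge0 dot d) : forall v : 'cV[R]_n,
      0 <= (v^T *m (- (M^T *m M + N + N^T - 2%:M)) *m v) 0 0.
    by move=> v; rewrite mulmxN mulNmx mxE oppr_ge0; exact: MN_nsd.2.
  rewrite kron_idN_mx !kron_idD_mx kron_idN_mx kron_idM kron_id_scalar.
  by rewrite -/dotn !dotE trM trN; lra.
have main (z z' : {ffun 'I_m -> H}) (x x' : {ffun 'I_n -> H}) :
    is_resolvent_point F S N z x -> is_resolvent_point F S N z' x' ->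
    dot_norm dotm (T z - T z') ^+ 2
    + (1 - gamma) / gamma
      * dot_norm dotm ((z - T z) - (z' - T z')) ^+ 2
    + gamma * dotn (x - x')
        (2 *: (x - x')
         - adjoint dotn dotm (kron_id M) (kron_id M (x - x'))
         - kron_id N (x - x')
         - adjoint dotn dotn (kron_id N) (x - x'))
    <= dot_norm dotm (z - z') ^+ 2.
  move=> zx zx'; rewrite !dot_normK defectE.
  have TE u v : is_resolvent_point F S N u v -> T u = u + gamma *: kron_id M v.
    by move=> /(resolvent_point_unique N_trig N_diag) <-.
  have -> : T z - T z' = (z - z') + gamma *: kron_id M (x - x').
    by rewrite !(TE _ _ zx, TE _ _ zx') kron_idB scalerBr opprD addrACA.
  have -> : (z - T z) - (z' - T z') = - (gamma *: kron_id M (x - x')).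
    have cancel (u v : {ffun 'I_m -> H}) : u - (u + v) = - v.
      by rewrite opprD addrA subrr sub0r.
    by rewrite (TE _ _ zx) (TE _ _ zx') !cancel -opprD kron_idB scalerBr.
  rewrite [dotm (- _) _]dotNl dotNr opprK.
  apply: (@km_inequality _ _ _ _ _ _ _ _ _ (kron_id S (z - z'))) => //.
    have trS : dotn (kron_id S (z - z')) (x - x')
        = dotm (z - z') (kron_id S^T (x - x')) by exact: pdot_kron_tr.
    by rewrite dotC trS S_M kron_idN_mx dotNr dotC.
  have := resolvents_monotone dot_normE (kron_id S z + kron_id N x)
    (kron_id S z' + kron_id N x') F_maxmon.
  by rewrite /= -zx -zx' opprD addrACA -!kron_idB.
split=> // gamma_lt1; split=> [|z z']; first by rewrite gamma_gt0.
have zx := resolvent_pointP F S N_trig N_diag z.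
have zx' := resolvent_pointP F S N_trig N_diag z'.
apply: le_trans (main _ _ _ _ zx zx').
rewrite lerDl mulr_ge0 ?(ltW gamma_gt0)//.
by rewrite defectE; exact: defect_ge0.
Qed.
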